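(* Let $L$ be a frame, let $(P;e)$ be a fuzzy dcpo with $P$ non-empty, let $H_P$ be the set of all monotone maps $(P;e)\to(P;e)$ with the $L$-order $\overline e(f,g)=\bigwedge_{x\in P}e(f(x),g(x))$, let $S:H_P\to L$ be defined by $S(\alpha)=\overline e(Id_P,\alpha)$ for all $\alpha\in H_P$, and let $\beta=\sqcup S$ be the join of $S$ in $(H_P;\overline e)$ (which exists). Then: (i) For each $x\in P$ and each $f\in H_P$, $\beta(x)$ is a $t$-fixpoint of $f$, where $t=S(f)\wedge S(\beta)$. (ii) For each $f\in H_P$, $S(f)\le\overline e(f,\beta\circ f)$. (iii) For each $f\in H_P$, there exists $u\in P$ such that $S(f)\wedge S(\beta)\le e(f(u),u)\wedge e(u,f(u))$. (iv) If $f\in H_P$ is such that $S(f)=1$, then $f\circ\beta=\beta$. That is, $\beta(x)$ is a fixpoint of $f$ for all $x\in P$.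
   Context: A frame is a complete lattice $L$ (with bottom $0$, top $1$) satisfying $a\wedge\bigvee S=\bigvee_{s\in S}(a\wedge s)$ for all $a\in L$, $S\subseteq L$; its relative pseudocomplement is $a\to b=\bigvee\{x\in L\mid a\wedge x\le b\}$. $L^X$ is the set of all maps $X\to L$. An $L$-ordered set is a pair $(X;e)$ with $X$ a set and $e:X\times X\to L$ a map such that for all $x,y,z\in X$: (E1) $e(x,x)=1$; (E2) $e(x,y)\wedge e(y,z)\le e(x,z)$; (E3) $e(x,y)=e(y,x)=1$ implies $x=y$. For $S\in L^X$, an element $x_0\in X$ is the join of $S$, written $x_0=\sqcup S$, if for all $x\in X$: $S(x)\le e(x,x_0)$ and $\bigwedge_{y\in X}(S(y)\to e(y,x))\le e(x_0,x)$. Joins are unique when they exist. $D\in L^X$ is a fuzzy directed subset of $(X;e)$ if (FD1) $\bigvee_{x\in X}D(x)=1$ and (FD2) for all $x,y\in X$, $D(x)\wedge D(y)\le\bigvee_{z\in X}(D(z)\wedge e(x,z)\wedge e(y,z))$. An $L$-ordered set is a fuzzy dcpo if every fuzzy directed subset of it has a join. A map $f:(P;e)\to(P;e)$ is monotone if $e(x,y)\le e(f(x),f(y))$ for all $x,y\in P$. $Id_P$ is the identity map of $P$. For $t\in L$ and a monotone $f:(P;e)\to(P;e)$, an element $x\in P$ is a $t$-fixpoint of $f$ if $t\le e(x,f(x))\wedge e(f(x),x)$. A fixpoint of $f$ is an $x$ with $f(x)=x$. *)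

(* Defs.v *)
From HB Require Import structures.
#[warnings="-notation-overridden"]
From mathcomp Require Import all_boot all_order.
From mathcomp Require Import boolp classical_sets.

Set Implicit Arguments.
Unset Strict Implicit.
Unset Printing Implicit Defensive.

Import Order.TTheory.

Local Open Scope order_scope.

(* The relations `supremums S x` and `infimums S x` say that x is a least
   upper bound, respectively a greatest lower bound, of S. *)
HB.mixin Record TBLattice_isFrame d (L : Type) of Order.TBLattice d L := {
  bigjoin : set L -> L;
  bigmeet : set L -> L;
  bigjoinP : forall S : set L, supremums S (bigjoin S);
  bigmeetP : forall S : set L, infimums S (bigmeet S);
  meet_bigjoin : forall (a : L) (S : set L),
    a `&` bigjoin S = bigjoin [set (a `&` s)%O | s in S]%classic
}.

#[short(type="frameType")]
HB.structure Definition Frame d :=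
  { L of TBLattice_isFrame d L & Order.TBLattice d L }.

Section FrameOperations.
Context {d : Order.disp_t} {L : frameType d}.

Definition joinI {I : Type} (F : I -> L) : L := bigjoin (range F).

Definition meetI {I : Type} (F : I -> L) : L := bigmeet (range F).

Definition rpc (a b : L) : L := bigjoin [set x : L | (a `&` x <= b)%O]%classic.

End FrameOperations.

HB.mixin Record isLOrdered d (L : frameType d) (X : Type) := {
  lord : X -> X -> L;
  lord_refl : forall x, lord x x = \top;
  lord_trans : forall x y z, lord x y `&` lord y z <= lord x z;
  lord_anti : forall x y, lord x y = \top -> lord y x = \top -> x = y
}.

#[short(type="lorderedType")]
HB.structure Definition LOrdered d (L : frameType d) :=
  { X of isLOrdered d L X }.

Section LOrderedSets.
Context {d : Order.disp_t} {L : frameType d}.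

Definition is_ljoin (X : lorderedType L) (S : X -> L) (x0 : X) : Prop :=
  forall x : X, S x <= lord x x0 /\
    meetI (fun y : X => rpc (S y) (lord y x)) <= lord x0 x.

Definition fuzzy_directed (X : lorderedType L) (D : X -> L) : Prop :=
  joinI D = \top /\
  forall x y : X, D x `&` D y <=
    joinI (fun z : X => D z `&` lord x z `&` lord y z).

Definition fuzzy_dcpo (X : lorderedType L) : Prop :=
  forall D : X -> L, fuzzy_directed D -> exists x0 : X, is_ljoin D x0.

Definition lmonotone (X Y : lorderedType L) (f : X -> Y) : Prop :=
  forall x y : X, lord x y <= lord (f x) (f y).

Record lmono (X Y : lorderedType L) := LMono {
  lmono_fun :> X -> Y;
  lmonoP : lmonotone lmono_fun
}.

Lemma lmono_eq (X Y : lorderedType L) (f g : lmono X Y) :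
  (forall x, f x = g x) -> f = g.
Proof.
case: f g => [f fP] [g gP] /= fg.
have efg : f = g by exact: funext.
by subst g; rewrite (Prop_irrelevance fP gP).
Qed.

Lemma lmonotone_id (X : lorderedType L) : lmonotone (@id X).
Proof. by move=> x y. Qed.

Definition lmono_id (X : lorderedType L) : lmono X X :=
  LMono (@lmonotone_id X).

Lemma lmonotone_comp (X Y Z : lorderedType L) (g : lmono Y Z) (f : lmono X Y) :
  lmonotone (g \o f).
Proof. by move=> x y; exact: le_trans (lmonoP f x y) (lmonoP g _ _). Qed.

Definition lmono_comp (X Y Z : lorderedType L) (g : lmono Y Z) (f : lmono X Y) :
  lmono X Z := LMono (lmonotone_comp g f).

Definition lmono_ord (X Y : lorderedType L) (f g : lmono X Y) : L :=
  meetI (fun x : X => lord (f x) (g x)).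

Lemma meetI_le {I : Type} (F : I -> L) (i : I) : meetI F <= F i.
Proof. by have [+ _] := bigmeetP (range F); apply; exists i. Qed.

Lemma le_meetI {I : Type} (F : I -> L) (a : L) :
  (forall i, a <= F i) -> a <= meetI F.
Proof.
by have [_ +] := bigmeetP (range F) => + aF; apply=> _ [i _ <-]; exact: aF.
Qed.

Lemma lmono_ord_refl (X Y : lorderedType L) (f : lmono X Y) :
  lmono_ord f f = \top.
Proof.
by apply/eqP; rewrite -le1x; apply: le_meetI => x; rewrite lord_refl.
Qed.

Lemma lmono_ord_trans (X Y : lorderedType L) (f g h : lmono X Y) :
  lmono_ord f g `&` lmono_ord g h <= lmono_ord f h.
Proof.
apply: le_meetI => x; apply: le_trans (lord_trans (f x) (g x) (h x)).
by apply: leI2; exact: meetI_le.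
Qed.

Lemma lmono_ord_anti (X Y : lorderedType L) (f g : lmono X Y) :
  lmono_ord f g = \top -> lmono_ord g f = \top -> f = g.
Proof.
move=> fg gf; apply: lmono_eq => x.
apply: lord_anti; apply/eqP; rewrite -le1x.
  by rewrite -fg; exact: (meetI_le (fun x : X => lord (f x) (g x))).
by rewrite -gf; exact: (meetI_le (fun x : X => lord (g x) (f x))).
Qed.

HB.instance Definition _ (X Y : lorderedType L) :=
  isLOrdered.Build d L (lmono X Y)
    (@lmono_ord_refl X Y) (@lmono_ord_trans X Y) (@lmono_ord_anti X Y).

Definition t_fixpoint (P : lorderedType L) (t : L) (f : lmono P P) (x : P) :
  Prop := t <= lord x (f x) `&` lord (f x) x.

Definition fixpoint (P : lorderedType L) (f : P -> P) (x : P) : Prop := f x = x.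

End LOrderedSets.

(* Main.v *)
(* The composite f \o g is an upper bound of f and g to the degree S f `&` S g,
   so S is fuzzy directed. Its join beta exists because joins of fuzzy directed
   families of monotone maps into a fuzzy dcpo are computed pointwise. Since
   S id = \top, also S beta = \top; and as beta dominates f \o beta to the
   degree S (f \o beta) >= S f `&` S beta, it absorbs f to that degree. *)
Require Import Defs.
From mathcomp Require Import all_boot all_order.
From mathcomp Require Import boolp classical_sets.

Set Implicit Arguments.
Unset Strict Implicit.
Unset Printing Implicit Defensive.

Import Order.TTheory.

Local Open Scope order_scope.

Section FrameTheory.
Context {d : Order.disp_t} {L : frameType d}.

Lemma le_joinI {I : Type} (F : I -> L) (i : I) : F i <= joinI F.
Proof. by have [+ _] := bigjoinP (range F); apply; exists i. Qed.

Lemma joinI_le {I : Type} (F : I -> L) (a : L) :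
  (forall i, F i <= a) -> joinI F <= a.
Proof.
by have [_ +] := bigjoinP (range F) => + Fa; apply=> _ [i _ <-]; exact: Fa.
Qed.

Lemma meet_joinI {I : Type} (a : L) (F : I -> L) :
  a `&` joinI F = joinI (fun i => a `&` F i).
Proof. by rewrite /joinI meet_bigjoin image_comp. Qed.

Lemma meet_joinI_le {I : Type} (a b : L) (F : I -> L) :
  (forall i, a `&` F i <= b) -> a `&` joinI F <= b.
Proof. by move=> Fb; rewrite meet_joinI; exact: joinI_le. Qed.

Lemma joinI_meet_le {I : Type} (a b : L) (F : I -> L) :
  (forall i, F i `&` a <= b) -> joinI F `&` a <= b.
Proof.
by move=> Fb; rewrite meetC; apply: meet_joinI_le => i; rewrite meetC.
Qed.

(** Heyting adjunction: from left to right, frame distributivity turns the meet of [a] with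
    [rpc a b] into a join of meets, each below [b]. *)
Lemma le_rpc (a b x : L) : (x <= rpc a b) = (a `&` x <= b).
Proof.
have [ub lub] := bigjoinP [set y : L | (a `&` y <= b)%O]%classic.
apply/idP/idP => [xab | axb]; last exact: ub.
apply: (le_trans (leI2 (lexx a) xab)); rewrite /rpc meet_bigjoin.
have [_] := bigjoinP [set (a `&` y)%O | y in
  [set y : L | (a `&` y <= b)%O]]%classic.
by apply=> _ [y ayb <-].
Qed.

Lemma is_ljoin_ub (X : lorderedType L) (S : X -> L) (x0 x : X) :
  is_ljoin S x0 -> S x <= lord x x0.
Proof. by case/(_ x). Qed.

Lemma is_ljoin_least (X : lorderedType L) (S : X -> L) (x0 x : X) (a : L) :
  is_ljoin S x0 -> (forall y, S y `&` a <= lord y x) -> a <= lord x0 x.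
Proof.
move=> /(_ x)[_ least] Sa; apply: le_trans least.
by apply: le_meetI => y; rewrite le_rpc.
Qed.

(** At a fixed degree [a], [lord] acts as an ordinary preorder, so comparisons can be chained point
    by point. *)
Lemma le_lord_trans (X : lorderedType L) (y x z : X) (a : L) :
  a <= lord x y -> a <= lord y z -> a <= lord x z.
Proof. by move=> axy ayz; apply: le_trans (lord_trans x y z); rewrite lexI axy. Qed.

End FrameTheory.

Section MonotoneMaps.
Context {d : Order.disp_t} {L : frameType d}.

Lemma lmono_lordP (X Y : lorderedType L) (f g : lmono X Y) (x : X) :
  lord f g <= lord (f x) (g x).
Proof. exact: (meetI_le (fun x : X => lord (f x) (g x))). Qed.

Lemma le_lmono_lord (X Y : lorderedType L) (f g : lmono X Y) (a : L) :
  (forall x, a <= lord (f x) (g x)) -> a <= lord f g.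
Proof. exact: le_meetI. Qed.

(* Passing to the lower set generated by the values f x keeps every
   verification below free of equality of points. *)
Definition eval_down (X Y : lorderedType L) (D : lmono X Y -> L) (x : X) (y : Y) :
  L := joinI (fun f : lmono X Y => D f `&` lord y (f x)).

Lemma le_eval_down (X Y : lorderedType L) (D : lmono X Y -> L) (f : lmono X Y)
    (x : X) : D f <= eval_down D x (f x).
Proof.
apply: le_trans (le_joinI (fun f : lmono X Y => D f `&` lord _ (f x)) f).
by rewrite lord_refl meetx1.
Qed.

(** If [y] is below [f x] and [z] below [g x], then any [h] above [f] and [g] in [D] yields the
    common bound [h x]. *)
Lemma fuzzy_directed_eval_down (X Y : lorderedType L) (D : lmono X Y -> L)
    (x : X) : fuzzy_directed D -> fuzzy_directed (eval_down D x).
Proof.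
move=> [D1 D2]; split=> [|y z].
  apply/eqP; rewrite -le1x -D1; apply: joinI_le => f.
  exact: le_trans (le_eval_down D f x) (le_joinI _ _).
apply: joinI_meet_le => f; apply: meet_joinI_le => g.
rewrite meetACA meetC; apply: le_trans (leI2 (lexx _) (D2 f g)) _.
apply: meet_joinI_le => h.
pose F w := eval_down D x w `&` lord y w `&` lord z w.
apply: le_trans (le_joinI F (h x)); rewrite {}/F.
(* Splitting the trivial [a <= a] turns each factor of the meet into a hypothesis. *)
set a := (X in X <= _).
have : a <= a by [].
rewrite {2}/a !lexI => /andP[/andP[ay az] /andP[/andP[ah afh] agh]].
rewrite (le_trans ah (le_eval_down _ _ _)) /=; apply/andP; split.
  exact: le_lord_trans ay (le_trans afh (lmono_lordP _ _ _)).
exact: le_lord_trans az (le_trans agh (lmono_lordP _ _ _)).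
Qed.

Lemma is_ljoin_eval_down (X Y : lorderedType L) (D : lmono X Y -> L)
    (b : X -> Y) : (forall x, is_ljoin (eval_down D x) (b x)) ->
  exists beta : lmono X Y, is_ljoin D beta.
Proof.
move=> bP.
have Dfb f x : D f <= lord (f x) (b x).
  exact: le_trans (le_eval_down D f x) (is_ljoin_ub _ (bP x)).
(* Bounding the values [f x] suffices: each term of the join defining membership of [z] places [z]
   below some [f x]. *)
have b_least x y a :
    (forall f : lmono X Y, D f `&` a <= lord (f x) y) -> a <= lord (b x) y.
  move=> Da; apply: is_ljoin_least (bP x) _ => z; apply: joinI_meet_le => f.
  apply: (le_lord_trans (y := f x)); first by rewrite leIxl // leIr.
  by apply: le_trans (Da f); rewrite leI2 // leIl.
(* To the degree [lord x y], each [f x] is below [f y], hence below [b y]; leastness of [b x]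
   concludes. *)
have b_mono : lmonotone b.
  move=> x y; apply: b_least => f; apply: (le_lord_trans (y := f y)).
    by rewrite leIxr // lmonoP.
  by rewrite leIxl.
exists (LMono b_mono) => g; split; first exact: le_lmono_lord.
apply: le_lmono_lord => x; apply: b_least => f.
(* Instantiate the meet at [f], then pass from [lord f g] to its value at [x] by modus ponens for
   [rpc]. *)
rewrite -le_rpc; apply: le_trans (meetI_le _ f) _.
rewrite le_rpc; apply: le_trans (lmono_lordP f g x).
by rewrite -le_rpc.
Qed.

Lemma fuzzy_dcpo_lmono (X Y : lorderedType L) :
  fuzzy_dcpo Y -> fuzzy_dcpo (lmono X Y).
Proof.
move=> dcpoY D Ddir.
have /choice[b bP] x := dcpoY _ (fuzzy_directed_eval_down x Ddir).
exact: is_ljoin_eval_down bP.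
Qed.

Lemma inflation_comp (P : lorderedType L) (f g : lmono P P) :
  lord (lmono_id P) f `&` lord (lmono_id P) g
    <= lord (lmono_id P) (lmono_comp f g).
Proof.
apply: le_lmono_lord => x; apply: (le_lord_trans (y := g x)).
  by rewrite leIxr // (lmono_lordP (lmono_id P) g).
by rewrite leIxl // (lmono_lordP (lmono_id P) f (g x)).
Qed.

(** The identity has degree [\top]. The composite is above [f] since [f] is monotone and [x] is
    below [g x], and above [g] by inflation of [f] at [g x]. *)
Lemma fuzzy_directed_inflation (P : lorderedType L) :
  fuzzy_directed (fun f : lmono P P => lord (lmono_id P) f).
Proof.
split=> [|f g].
  apply/eqP; rewrite -le1x -(lord_refl (lmono_id P)).
  exact: (le_joinI (fun f => lord (lmono_id P) f)).
pose F (h : lmono P P) := lord (lmono_id P) h `&` lord f h `&` lord g h.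
apply: le_trans (le_joinI F (lmono_comp f g)).
rewrite !lexI inflation_comp /=; apply/andP; split; apply: le_lmono_lord => x.
  rewrite leIxr //; apply: le_trans (lmonoP f x (g x)).
  exact: (lmono_lordP (lmono_id P) g).
by rewrite leIxl // (lmono_lordP (lmono_id P) f (g x)).
Qed.

End MonotoneMaps.

Theorem corollary4p4 (d : Order.disp_t) (L : frameType d) (P : lorderedType L)
    (dcpoP : fuzzy_dcpo P) (P0 : inhabited P) :
  let S : lmono P P -> L := fun alpha => lord (lmono_id P) alpha in
  (exists beta : lmono P P, is_ljoin S beta) /\
  forall beta : lmono P P, is_ljoin S beta ->
    [/\ (forall (x : P) (f : lmono P P),
           t_fixpoint (S f `&` S beta) f (beta x)),
        (forall f : lmono P P, S f <= lord f (lmono_comp beta f)),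
        (forall f : lmono P P, exists u : P,
           S f `&` S beta <= lord (f u) u `&` lord u (f u))
      & (forall f : lmono P P, S f = \top ->
           f \o beta = beta :> (P -> P) /\
           forall x : P, fixpoint f (beta x))].
Proof.
move=> S; split.
  by apply: fuzzy_dcpo_lmono dcpoP _ _; exact: fuzzy_directed_inflation.
move=> beta betaP.
have Sbeta : S beta = \top.
  apply/eqP; rewrite -le1x -(lord_refl (lmono_id P)).
  exact: (is_ljoin_ub (lmono_id P) betaP).
(* One half is inflation of [f] at [beta x]; the other is the upper bound property of [beta] applied
   to [f \o beta]. *)
have fixb x f : t_fixpoint (S f `&` S beta) f (beta x).
  rewrite /t_fixpoint lexI leIxl ?(lmono_lordP (lmono_id P) f (beta x)) //=.
  apply: le_trans (lmono_lordP (lmono_comp f beta) beta x).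
  exact: le_trans (inflation_comp f beta) (is_ljoin_ub _ betaP).
have fixf f x : S f = \top -> f (beta x) = beta x.
  move=> Sf; have := fixb x f; rewrite /t_fixpoint Sf Sbeta meetx1 lexI.
  by rewrite !le1x => /andP[/eqP bf /eqP fb]; exact: lord_anti.
split=> // [f | f | f Sf].
(* As [S beta] is [\top], [f x] is below [beta (f x)] to the degree [\top]. *)
- apply: le_lmono_lord => x; apply: le_trans (lex1 _) _.
  by rewrite -Sbeta; exact: (lmono_lordP (lmono_id P) beta (f x)).
(* Any value of [beta] serves as [u]; a point of [P] provides one. *)
- by have [x] := P0; exists (beta x); rewrite [leRHS]meetC; exact: fixb.
- by split=> [|x]; [apply: funext => x /= |]; exact: fixf.
Qed.
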